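(* Every $\aleph_1$-free abelian group is lcH-slender; that is, if $H$ is an $\aleph_1$-free abelian group, $G$ is a locally compact Hausdorff topological group, and $\phi:G\to H$ is an abstract group homomorphism, then $\ker(\phi)$ is open in $G$.
   Context: An abelian group is $\aleph_1$-free abelian if every countable subgroup is free abelian. A group $H$ is lcH-slender if every abstract homomorphism from a locally compact Hausdorff topological group to $H$ has open kernel. *)

(* Defs.v *)
From Stdlib Require List.
From HB Require Import structures.
From mathcomp Require Import all_boot all_order all_algebra.
Set Implicit Arguments. Unset Strict Implicit. Unset Printing Implicit Defensive.
Import GRing.Theory.
Local Open Scope ring_scope.

Record topGroup := TopGroup {
  tg_car :> Type;
  tg_mul : tg_car -> tg_car -> tg_car;
  tg_inv : tg_car -> tg_car;
  tg_one : tg_car;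
  tg_open : (tg_car -> Prop) -> Prop;
  tg_mulA : forall x y z, tg_mul x (tg_mul y z) = tg_mul (tg_mul x y) z;
  tg_mul1g : forall x, tg_mul tg_one x = x;
  tg_mulVg : forall x, tg_mul (tg_inv x) x = tg_one;
  tg_open_setT : tg_open (fun _ => True);
  tg_open_bigcup : forall F : (tg_car -> Prop) -> Prop,
      (forall U, F U -> tg_open U) ->
      tg_open (fun x => exists2 U, F U & U x);
  tg_open_setI : forall U V, tg_open U -> tg_open V ->
      tg_open (fun x => U x /\ V x);
  tg_mul_cont : forall (W : tg_car -> Prop) x y, tg_open W -> W (tg_mul x y) ->
      exists U V, [/\ tg_open U, tg_open V, U x, V y &
                     forall a b, U a -> V b -> W (tg_mul a b)];
  tg_inv_cont : forall W, tg_open W -> tg_open (fun x => W (tg_inv x))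
}.

Definition hausdorff (G : topGroup) : Prop :=
  forall x y : G, x <> y ->
    exists U V, [/\ tg_open U, tg_open V, U x, V y &
                   forall z, U z -> V z -> False].

Definition compact (G : topGroup) (K : G -> Prop) : Prop :=
  forall F : (G -> Prop) -> Prop,
    (forall U, F U -> tg_open U) ->
    (forall x, K x -> exists2 U, F U & U x) ->
    exists l : list (G -> Prop),
      (forall U, List.In U l -> F U) /\
      (forall x, K x -> exists2 U, List.In U l & U x).

Definition locally_compact (G : topGroup) : Prop :=
  forall x : G, exists U K, [/\ tg_open U, U x, compact K &
                                forall z, U z -> K z].

Definition group_hom (G : topGroup) (H : zmodType) (phi : G -> H) : Prop :=
  forall x y : G, phi (tg_mul x y) = phi x + phi y.

Definition subgroup (H : zmodType) (S : H -> Prop) : Prop :=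
  [/\ S 0, (forall x y, S x -> S y -> S (x + y)) & (forall x, S x -> S (- x))].

Definition countable_set (H : zmodType) (S : H -> Prop) : Prop :=
  exists f : H -> nat, forall x y, S x -> S y -> f x = f y -> x = y.

Definition is_basis (H : zmodType) (S B : H -> Prop) : Prop :=
  [/\ (forall b, B b -> S b),
      (forall x, S x -> exists (s : seq H) (c : H -> int),
          (forall h, h \in s -> B h) /\ x = \sum_(h <- s) h *~ c h) &
      (forall (s : seq H) (c : H -> int),
          uniq s -> (forall h, h \in s -> B h) ->
          \sum_(h <- s) h *~ c h = 0 -> forall h, h \in s -> c h = 0)].

Definition free_abelian_subgroup (H : zmodType) (S : H -> Prop) : Prop :=
  subgroup S /\ exists B, is_basis S B.

Definition aleph1_free (H : zmodType) : Prop :=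
  forall S : H -> Prop, subgroup S -> countable_set S -> free_abelian_subgroup S.

Definition lcH_slender (H : zmodType) : Prop :=
  forall (G : topGroup) (phi : G -> H),
    locally_compact G -> hausdorff G -> group_hom phi ->
    tg_open (fun x => phi x = 0).

(* Main.v *)
Require Import Defs.
From HB Require Import structures.
From mathcomp Require Import all_boot all_order all_algebra.
From mathcomp Require Import boolp classical_sets filter zify.

Set Implicit Arguments.
Unset Strict Implicit.
Unset Printing Implicit Defensive.

Import Order.TTheory GRing.Theory Num.Theory.
Local Open Scope ring_scope.

(** An aleph_1-free group H contains no nonzero element h that is divisible by
    every positive integer, and no h <> 0 for which the system
    y_n = h + (n + 2) y_(n+1) is solvable: some integer-valued functional on the
    countable subgroup involved is nonzero on h, and in the integers the y_n are
    bounded, hence eventually zero.  Solving this system in G by infinite words,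
    which converge along an ultrafilter in a compact neighbourhood V of 1, shows
    that N = ker phi is closed, and then that no g outside N has all its powers
    in V N.  If N is not open, let g tend to 1 outside N along an ultrafilter and
    let m(g) be maximal such that g, ..., g^m(g) lie in V N.  The limit of g^m(g)
    modulo N is not in N, but it is the k-th power, modulo N, of the limit of
    g^(m(g) / k) for every k, a contradiction. *)

(** * Coordinates in free abelian groups *)

Section FreeAbelian.
Variables (H : zmodType) (S B : H -> Prop).
Hypotheses (subS : subgroup S) (basisB : is_basis S B).

(** Vanishing off [s] makes [c] depend on [x] alone, so uniqueness is an equality of functions on
    [H]. *)
Definition has_coords (x : H) (c : H -> int) : Prop :=
  exists s : seq H, [/\ uniq s, (forall h, h \in s -> B h),
    (forall h, h \notin s -> c h = 0) & x = \sum_(h <- s) h *~ c h].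

Lemma ex_coords x : S x -> exists c, has_coords x c.
Proof.
case: basisB => _ gen _ /gen[s [c [sB ->]]].
exists (fun h => c h *+ count_mem h s); exists (undup s); split.
- exact: undup_uniq.
- by move=> h; rewrite mem_undup; exact: sB.
- by move=> h; rewrite mem_undup => /count_memPn ->.
- rewrite -big_undup_iterop_count; apply: eq_bigr => h _.
  by rewrite -mulr_natr mulrzA natz.
Qed.

Lemma sum_coords_widen (s t : seq H) (c : H -> int) :
  uniq s -> uniq t -> {subset s <= t} -> (forall h, h \notin s -> c h = 0) ->
  \sum_(h <- s) h *~ c h = \sum_(h <- t) h *~ c h.
Proof.
move=> us ut st c0; rewrite [RHS](bigID (mem s)) /= [X in _ + X]big1 ?addr0.
  rewrite -[RHS]big_filter; apply: perm_big; apply: uniq_perm => //.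
    exact: filter_uniq.
  by move=> h; rewrite mem_filter /=; case: (boolP (h \in s)) => // /st ->.
by move=> h /c0 ->; rewrite mulr0z.
Qed.

Lemma has_coordsB x y c d :
  has_coords x c -> has_coords y d -> has_coords (x - y) (fun h => c h - d h).
Proof.
move=> [s [us sB s0 ->]] [t [ut tB t0 ->]].
exists (undup (s ++ t)); split.
- exact: undup_uniq.
- by move=> h; rewrite mem_undup mem_cat => /orP[/sB|/tB].
- by move=> h; rewrite mem_undup mem_cat negb_or => /andP[/s0 -> /t0 ->].
- rewrite (@sum_coords_widen s (undup (s ++ t)) c) ?undup_uniq //; last first.
    by move=> h hs; rewrite mem_undup mem_cat hs.
  rewrite (@sum_coords_widen t (undup (s ++ t)) d) ?undup_uniq //; last first.
    by move=> h hs; rewrite mem_undup mem_cat hs orbT.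
  by rewrite -sumrB; apply: eq_bigr => h _; rewrite mulrzBr.
Qed.

Lemma coords_unique x c d : has_coords x c -> has_coords x d -> c =1 d.
Proof.
move=> xc xd h; have [s [us sB s0]] := has_coordsB xc xd.
rewrite subrr => /esym e; apply/eqP; rewrite -subr_eq0; apply/eqP.
have [hs|/s0 //] := boolP (h \in s).
by case: basisB => _ _ /(_ s _ us sB e h hs).
Qed.

(** Some coordinate of [x] is nonzero, say at [b]; [p] is the coordinate at [b], additive on [S] by
    uniqueness. *)
Lemma free_functional x : S x -> x <> 0 ->
  exists2 p : H -> int, p x <> 0 &
    forall y z, S y -> S z -> p (y + z) = p y + p z.
Proof.
move=> Sx x0.
have /choice[C CP] : forall y, exists c, S y -> has_coords y c.
  move=> y; have [Sy|nSy] := pselect (S y); last by exists (fun=> 0).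
  by have [c yc] := ex_coords Sy; exists c.
have [b Cb] : exists b, C x b <> 0.
  apply: contrapT => /forallNP C0; apply: x0.
  have [s [_ _ _ ->]] := CP x Sx; rewrite big1 // => h _.
  by have /contrapT -> := C0 h; rewrite mulr0z.
exists (C ^~ b) => // y z Sy Sz.
have Syz : S (y + z) by case: subS => _ + _; apply.
have := has_coordsB (CP _ Syz) (CP _ Sz).
by rewrite addrK => /(coords_unique (CP _ Sy)) /(_ b) /= ->; rewrite subrK.
Qed.

End FreeAbelian.

(** * Divisibility and recurrences in aleph_1-free groups *)

Section Aleph1Free.
Variable H : zmodType.
Hypothesis Hfree : aleph1_free H.

(** Finite coefficient lists reduce countability to encoding lists of integers. *)
Definition seq_span (y : nat -> H) (x : H) : Prop :=
  exists s : seq int, x = \sum_(i < size s) y i *~ nth 0 s i.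

Lemma seq_spanE (y : nat -> H) (s : seq int) n : (size s <= n)%N ->
  \sum_(i < size s) y i *~ nth 0 s i = \sum_(i < n) y i *~ nth 0 s i.
Proof.
move=> sn; rewrite (big_ord_widen n (fun i => y i *~ nth 0 s i)) // big_mkcond.
apply: eq_bigr => i _; case: ltnP => // si.
by rewrite nth_default // mulr0z.
Qed.

Lemma subgroup_seq_span y : subgroup (seq_span y).
Proof.
split; first by exists [::]; rewrite big_ord0.
- move=> _ _ [s ->] [t ->].
  exists (mkseq (fun i => nth 0 s i + nth 0 t i) (maxn (size s) (size t))).
  rewrite size_mkseq (seq_spanE _ (leq_maxl _ (size t))).
  rewrite (seq_spanE _ (leq_maxr (size s) _)) -big_split.
  by apply: eq_bigr => i _; rewrite nth_mkseq //= mulrzDr.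
- move=> _ [s ->]; exists (map -%R s); rewrite size_map -sumrN.
  by apply: eq_bigr => i _; rewrite (nth_map 0) // mulrNz.
Qed.

Lemma seq_span_mem y n : seq_span y (y n).
Proof.
exists (rcons (nseq n 0) 1); rewrite size_rcons size_nseq big_ord_recr /=.
rewrite nth_rcons size_nseq ltnn eqxx mulr1z big1 ?add0r // => i _.
by rewrite nth_rcons size_nseq ltn_ord nth_nseq ltn_ord mulr0z.
Qed.

Lemma countable_seq_span y : countable_set (seq_span y).
Proof.
have /choice[r rP] : forall x, exists s : seq int, seq_span y x ->
    x = \sum_(i < size s) y i *~ nth 0 s i.
  move=> x; have [[s xs]|nx] := pselect (seq_span y x); first by exists s.
  by exists [::].
exists (pickle \o r) => x z /rP xE /rP zE /= /(pcan_inj pickleK) rE.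
by rewrite xE zE rE.
Qed.

(** The functional comes from the countable span of [h] and all [y i], and its additivity is known
    only there. *)
Lemma aleph1_free_functional (h : H) (y : nat -> H) : h <> 0 ->
  exists p : H -> int, [/\ p h <> 0,
    (forall i n, p (y i *+ n) = p (y i) *+ n) &
    forall i n, p (h + y i *+ n) = p h + p (y i) *+ n].
Proof.
move=> h0; pose w n := if n is m.+1 then y m else h.
have subS := subgroup_seq_span w.
have [_ [B basisB]] := Hfree subS (countable_seq_span w).
have [p ph padd] := free_functional subS basisB (seq_span_mem w 0) h0.
have [S0 SD _] := subS.
have Sy i n : seq_span w (y i *+ n).
  elim: n => [//|n IH]; rewrite mulrS; apply: SD => //.
  exact: (seq_span_mem w i.+1).
have py i n : p (y i *+ n) = p (y i) *+ n.
  elim: n => [|n IH].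
    by apply: (addIr (p 0)); rewrite -padd // !addr0 add0r.
  by rewrite !mulrS padd ?IH //; exact: (Sy i 1).
exists p; split=> // i n.
by rewrite padd ?py //; exact: (seq_span_mem w 0).
Qed.

Lemma aleph1_free_divisible (h : H) :
  (forall m, exists x, h = x *+ m.+1) -> h = 0.
Proof.
move=> /choice[y yE]; apply: contrapT => h0.
have [p [ph py _]] := aleph1_free_functional y h0.
(* This index makes [p h] a multiple of [|p h| + 1], hence zero. *)
apply: ph; have := py `|p h|%N `|p h|.+1; rewrite -yE => e.
case: (eqVneq (p (y `|p h|%N)) 0) => [q0|]; first by rewrite e q0 mul0rn.
by rewrite -mulr_natr in e; nia.
Qed.

(** Dividing by n + 2 >= 2 keeps |y n| at most |y 0| + |c|; once n + 2 exceeds |y 0| + 2|c| it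
    forces y (n + 1) = 0, and two consecutive zeros give c = 0. *)
Lemma factorial_recurrence_int (c : int) (y : nat -> int) :
  (forall n, y n = c + y n.+1 *+ n.+2) -> c = 0.
Proof.
move=> yE.
have bnd n : (`|y n| <= `|y 0%N| + `|c|)%N.
  elim: n => [|n IH]; first exact: leq_addr.
  by have := yE n; rewrite -mulr_natr; nia.
have y0 n : (`|y 0%N| + `|c| + `|c| < n.+2)%N -> y n.+1 = 0.
  move=> ltn; have := yE n; have := bnd n; rewrite -mulr_natr => b1 b2.
  by case: (eqVneq (y n.+1) 0) => // ?; nia.
pose n := (`|y 0%N| + `|c| + `|c|)%N.
by have := yE n.+1; rewrite y0 ?y0 /n ?mul0rn ?addr0 //; lia.
Qed.

Lemma aleph1_free_recurrence (h : H) (y : nat -> H) :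
  (forall n, y n = h + y n.+1 *+ n.+2) -> h = 0.
Proof.
move=> yE; apply: contrapT => h0.
have [p [ph _ py]] := aleph1_free_functional y h0.
apply: ph; apply: (@factorial_recurrence_int _ (p \o y)) => n /=.
by rewrite -py -yE.
Qed.

End Aleph1Free.

(** * Topological groups *)

Section TopologicalGroup.
Variable G : topGroup.
Implicit Types (x y z g : G) (W K : G -> Prop).

Local Notation "x ** y" := (tg_mul x y) (at level 40, left associativity).
Local Notation "x ^!" := (tg_inv x).
Local Notation e := (tg_one G).

Fixpoint tg_pow x n : G := if n is m.+1 then tg_pow x m ** x else e.

Lemma tg_mulgV x : x ** x^! = e.
Proof.
rewrite -[x ** _]tg_mul1g -{1}(tg_mulVg x^!) -tg_mulA.
by rewrite [x^! ** (_ ** _)]tg_mulA tg_mulVg tg_mul1g tg_mulVg.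
Qed.

Lemma tg_mulg1 x : x ** e = x.
Proof. by rewrite -(tg_mulVg x) tg_mulA tg_mulgV tg_mul1g. Qed.

Lemma tg_invg1 : e^! = e.
Proof. by rewrite -[LHS]tg_mulg1 tg_mulVg. Qed.

Lemma tg_pow1 n : tg_pow e n = e.
Proof. by elim: n => //= n ->; rewrite tg_mulg1. Qed.

Lemma open_local W :
  (forall x, W x -> exists O, [/\ tg_open O, O x & forall y, O y -> W y]) ->
  tg_open W.
Proof.
move=> WP; pose F (O : G -> Prop) := tg_open O /\ forall y, O y -> W y.
suff -> : W = fun x => exists2 O, F O & O x by apply: tg_open_bigcup => O [].
apply/predeqP => x; split=> [/WP[O [oO Ox OW]]|[O [_]]]; last exact.
by exists O.
Qed.

Lemma nbhs1_mul_pow W k : tg_open W -> W e ->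
  exists W', [/\ tg_open W', W' e &
    forall a b, W' a -> W' b -> W (a ** tg_pow b k)].
Proof.
elim: k W => [|k IH] W oW We.
  by exists W; split=> // a b Wa _; rewrite /= tg_mulg1.
have [|U [V [oU oV Ue Ve UV]]] := @tg_mul_cont G W e e oW.
  by rewrite tg_mul1g.
have [W' [oW' W'e W'U]] := IH U oU Ue.
exists (fun x => W' x /\ V x); split=> // [|a b [W'a _] [W'b Vb]].
  exact: tg_open_setI.
by rewrite /= tg_mulA; apply: UV => //; apply: W'U.
Qed.

(** * Limits along an ultrafilter *)

Section UltraLimits.
Variables (I : Type) (F : set_system I).
Context {FU : UltraFilter F}.

Definition ulim (u : I -> G) x : Prop :=
  forall W, tg_open W -> W x -> F (fun i => W (u i)).

Lemma ulim_cst x : ulim (fun=> x) x.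
Proof. by move=> W _ Wx; apply: filterS filterT => i. Qed.

Lemma ulim_mul u v x y :
  ulim u x -> ulim v y -> ulim (fun i => u i ** v i) (x ** y).
Proof.
move=> ux vy W oW /(tg_mul_cont oW)[U [V [oU oV Ux Vy UV]]].
by apply: filterS2 (ux U oU Ux) (vy V oV Vy) => i; exact: UV.
Qed.

Lemma ulim_inv u x : ulim u x -> ulim (fun i => (u i)^!) x^!.
Proof. by move=> ux W /tg_inv_cont oW Wx; exact: (ux _ oW). Qed.

Lemma ulim_pow u x n :
  ulim u x -> ulim (fun i => tg_pow (u i) n) (tg_pow x n).
Proof.
by move=> ux; elim: n => [|n IH]; [exact: ulim_cst|exact: ulim_mul].
Qed.

Lemma ulim_closure u x W : ulim u x -> F (fun i => W (u i)) ->
  forall O, tg_open O -> O x -> exists2 y, O y & W y.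
Proof.
move=> ux FW O oO Ox; have FO := ux O oO Ox.
by have [i [Oi Wi]] := filter_ex (filterI FO FW); exists (u i).
Qed.

(** Otherwise open sets whose preimages are not in [F] cover [K]; the preimage of a finite union of
    them is not in [F] either. *)
Lemma compact_ulim K u : compact K -> F (fun i => K (u i)) ->
  exists2 x, K x & ulim u x.
Proof.
move=> cK FK; apply: contrapT => nlim.
pose C O := tg_open O /\ ~ F (fun i => O (u i)).
have [O []//|x Kx|l [lC Kl]] := cK C.
  apply: contrapT => nO; apply: nlim; exists x => // W oW Wx.
  by apply: contrapT => nF; apply: nO; exists W.
have : ~ F (fun i => exists2 O, List.In O l & O (u i)).
  elim: l lC {Kl} => [_|O l IH lC] FO.
    by have [i []] := filter_ex FO.
  have [_ nFO] := lC O (or_introl erefl).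
  apply: (IH (fun O' O'l => lC O' (or_intror O'l))).
  have [//|FnO] := in_ultra_setVsetC (fun i => O (u i)) FU.
  apply: filterS2 FO FnO => i [O' [<- //|O'l] O'i] _; by exists O'.
by apply; apply: filterS FK => i; exact: Kl.
Qed.

End UltraLimits.

(** * Kernels of homomorphisms into aleph_1-free groups *)

Section Homomorphism.
Variables (H : zmodType) (phi : G -> H).
Hypotheses (Hfree : aleph1_free H) (phiM : group_hom phi).

Lemma hom1 : phi e = 0.
Proof. by apply: (addIr (phi e)); rewrite -phiM tg_mul1g add0r. Qed.

Lemma homV x : phi x^! = - phi x.
Proof. by apply: (addIr (phi x)); rewrite -phiM tg_mulVg hom1 addNr. Qed.

Lemma homX x n : phi (tg_pow x n) = phi x *+ n.
Proof. by elim: n => [|n IH]; rewrite ?hom1 //= phiM IH mulrSr. Qed.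

(** [X d n] stands for the tail of the infinite word from letter [n], truncated at depth [d]. The
    truncations obey the recurrence up to errors in [M]; since the closure of [M] lies in the
    kernel, the images of their limits obey it exactly. *)
Lemma infinite_word (K M : G -> Prop) (g : nat -> G) (h : H)
    (X : nat -> nat -> G) :
  compact K -> (forall d n, K (X d n)) ->
  (forall x, (forall O, tg_open O -> O x -> exists2 y, O y & M y) ->
     phi x = 0) ->
  (forall n, phi (g n) = h) ->
  (forall d n, M (X d.+1 n ** (tg_pow (X d n.+1) n.+2)^! ** (g n)^!)) ->
  h = 0.
Proof.
move=> cK KX Mcl gh MX.
have [F [FU Foo]] := @ultraFilterLemma nat eventually _.
have /choice[x xlim] n : exists x, ulim F (fun N => X (N - n)%N n) x.
  have [|x _ xlim] := @compact_ulim _ F FU K (fun N => X (N - n)%N n) cK.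
    by apply: filterS filterT => N _; exact: KX.
  by exists x.
apply: (aleph1_free_recurrence Hfree (y := phi \o x)) => n /=.
apply/eqP; rewrite -subr_eq0 opprD addrA addrAC; apply/eqP.
rewrite -(gh n) -homX -!homV -!phiM; apply: Mcl.
apply: (@ulim_closure _ F _ (fun N => X (N - n)%N n **
  (tg_pow (X (N - n.+1)%N n.+1) n.+2)^! ** (g n)^!)).
  apply: ulim_mul; last exact: ulim_cst.
  by apply: ulim_mul => //; apply: ulim_inv; apply: ulim_pow.
(* For N > n, [N - n] is the successor of [N - n.+1]: both tails stop at the same letter. *)
apply: Foo; exists n.+1 => // N /= nN.
by rewrite -[(N - n)%N]subSS subSn.
Qed.

Hypotheses (lcG : locally_compact G) (hausG : hausdorff G).

(* A point g of the closure of the kernel has kernel-translates arbitrarily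
   close to the identity with the same value h, so an infinite word
   g_0 (g_1 (g_2 ...)^3)^2 converges for suitable such translates g_n. *)
Lemma kernel_closed g :
  (forall O, tg_open O -> O g -> exists2 y, O y & phi y = 0) -> phi g = 0.
Proof.
move=> gcl; have [U [K [oU Ue cK UK]]] := lcG e.
have small W : tg_open W -> W e -> exists2 a, W a & phi a = phi g.
  move=> oW We.
  have [|A [B [oA oB Ag Bg AB]]] := @tg_mul_cont G W g g^! oW.
    by rewrite tg_mulgV.
  have [y By y0] := gcl _ (tg_inv_cont oB) Bg.
  exists (g ** y^!); first exact: AB.
  by rewrite phiM homV y0 oppr0 addr0.
(* The neighbourhoods [W n] shrink so that a letter in [W n.+1] times the (n + 2)-th power of a tail
   in [W n.+1] lies in [W n]; all truncations then stay in [U]. *)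
have /choice[nxt nxtP] (p : nat * (G -> Prop)) :
    exists W', tg_open p.2 -> p.2 e -> [/\ tg_open W', W' e &
      forall a b, W' a -> W' b -> p.2 (a ** tg_pow b p.1)].
  have [oW|noW] := pselect (tg_open p.2); last by exists p.2.
  have [We|nWe] := pselect (p.2 e); last by exists p.2.
  by have [W' W'P] := nbhs1_mul_pow p.1 oW We; exists W'.
pose fix W n : G -> Prop := if n is m.+1 then nxt (m.+2, W m) else U.
have WP n : tg_open (W n) /\ W n e.
  by elim: n => [//|n [oW We]]; have [] := nxtP (n.+2, W n) oW We.
have WS n a b : W n.+1 a -> W n.+1 b -> W n (a ** tg_pow b n.+2).
  by have [oW We] := WP n; have [_ _] := nxtP (n.+2, W n) oW We; apply.
have WU n a : W n a -> U a.
  elim: n a => // n IH a Wa; apply: IH.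
  by have := WS n a e Wa (WP n.+1).2; rewrite tg_pow1 tg_mulg1.
have /choice[a aP] n : exists a, W n.+1 a /\ phi a = phi g.
  by have [oW We] := WP n.+1; have [a Wa ag] := small _ oW We; exists a.
pose fix X d n {struct d} : G := if d is d'.+1 then a n ** tg_pow (X d' n.+1) n.+2 else e.
have WX d n : W n (X d n).
  elim: d n => [|d IH] n; first exact: (WP n).2.
  by apply: WS => //; exact: (aP n).1.
(* The truncations obey the recurrence exactly, and {e} is closed as [G] is Hausdorff. *)
apply: (@infinite_word K (fun x => x = e) a (phi g) X) => //.
- by move=> d n; apply/UK/(WU n).
- move=> x xcl; suff -> : x = e by exact: hom1.
  apply: contrapT => /hausG[A [B [oA oB Ax Be AB]]].
  by have [y Ay ye] := xcl A oA Ax; apply: (AB y) => //; rewrite ye.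
- by move=> n; exact: (aP n).2.
- move=> d n /=; rewrite -[a n ** _ ** _]tg_mulA.
  by rewrite tg_mulgV tg_mulg1 tg_mulgV.
Qed.

Lemma kernel_open : tg_open (fun x => phi x = 0).
Proof.
have [U [K [oU Ue cK UK]]] := lcG e.
apply: contrapT => nopen.
have small W : tg_open W -> W e -> exists2 g, W g & phi g <> 0.
  move=> oW We; apply: contrapT => nW; apply: nopen; apply: open_local => x x0.
  have [|A [B [oA oB Ax Bx AB]]] := @tg_mul_cont G W x^! x oW.
    by rewrite tg_mulVg.
  exists B; split=> // y By; apply: contrapT => y0; apply: nW.
  exists (x^! ** y); first exact: AB.
  by rewrite phiM homV x0 oppr0 add0r.
(* That is, g^n lies in [K] times the kernel. *)
pose P g n := exists2 v, K v & phi v = phi g *+ n.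
have exit g : phi g <> 0 -> exists n, ~ P g n.
  move=> g0; apply: contrapT => /forallNP nP.
  have /choice[v vP] n : exists v, K v /\ phi v = phi g *+ n.
    by have /contrapT[v Kv vE] := nP n; exists v.
  (* [Y d n] is the exponent of the truncated word with all letters [g]; [v] replaces this power by
     an element of [K] with the same image. *)
  pose fix Y d n {struct d} : nat :=
     if d is d'.+1 then (1 + Y d' n.+1 * n.+2)%N else 0%N.
  apply: g0; apply: (@infinite_word K (fun x => phi x = 0) (fun=> g) (phi g)
    (fun d n => v (Y d n))) => //.
  - by move=> d n; exact: (vP _).1.
  - exact: kernel_closed.
  - move=> d n; rewrite !phiM !homV homX !(vP _).2 /= mulrnDr mulrnA.
    by rewrite addrK mulr1n subrr.
have /choice[m mP] g : exists m, phi g <> 0 ->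
    (forall j, (j <= m)%N -> P g j) /\ ~ P g m.+1.
  have [->|g0] := pselect (phi g = 0); first by exists 0%N.
  have [n0 nPn0] := exit g g0.
  have exn : exists n, `[< ~ P g n >] by exists n0; apply/asboolP.
  case: (ex_minnP exn) => -[|m] /asboolP nP minP.
    by case: nP; exists e; [exact: UK|rewrite hom1].
  exists m => _; split=> // j jm; apply: contrapT => /asboolP/minP.
  by rewrite ltnNge jm.
have /choice[v vP] (p : G * nat) : exists v, phi p.1 <> 0 ->
    (p.2 <= m p.1)%N -> K v /\ phi v = phi p.1 *+ p.2.
  have [p0|p0] := pselect (phi p.1 = 0); first by exists e.
  have [pm|pm] := boolP (p.2 <= m p.1)%N; last by exists e.
  by have [/(_ _ pm)[w Kw wE] _] := mP p.1 p0; exists w.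
(* The neighbourhoods of [e], restricted to the complement of the kernel; proper by [small]. *)
pose F0 (A : set G) := exists W, [/\ tg_open W, W e &
  forall g, W g -> phi g <> 0 -> A g].
have F0P : ProperFilter F0.
  split; first by move=> [W [oW We W0]]; have [g Wg /(W0 g Wg)] := small W oW We.
  split.
  - by exists U.
  - move=> A B [W [oW We WA]] [W' [oW' W'e W'B]].
    exists (fun x => W x /\ W' x); split=> //; first exact: tg_open_setI.
    by move=> g [Wg W'g] g0; split; [exact: WA|exact: W'B].
  - move=> A B AB [W [oW We WA]]; exists W; split=> // g Wg g0.
    by apply: AB; exact: WA.
have [F [FU F0F]] := ultraFilterLemma F0P.
have limid : ulim F id e by move=> W oW We; apply: F0F; exists W.
have Fnz : F (fun g => phi g <> 0) by apply: F0F; exists U.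
have lim (j : G -> nat) : (forall g, j g <= m g)%N ->
    exists2 x, K x & ulim F (fun g => v (g, j g)) x.
  move=> jm; apply: (compact_ulim cK); apply: filterS Fnz => g g0.
  by have [] := vP (g, j g) g0 (jm g).
have [x Kx xlim] := lim m (fun=> leqnn _).
(* With [x] in the kernel, v(g, m g) g x^-1 lies in [U] for some [g] and witnesses
   [P g (m g).+1]. *)
suff x0 : phi x = 0.
  have ylim : ulim F (fun g => (v (g, m g) ** g) ** x^!) e.
    rewrite -(tg_mulgV x) -{2}[x]tg_mulg1.
    by apply: ulim_mul; [exact: ulim_mul|exact: ulim_cst].
  have [g [Ug g0]] := filter_ex (filterI (ylim U oU Ue) Fnz).
  have [_ []] := mP g g0.
  exists (v (g, m g) ** g ** x^!); first exact: UK.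
  rewrite !phiM homV x0 oppr0 addr0 mulrSr.
  by have [//|_ ->] := vP (g, m g) g0.
(* Write m(g) = q (k + 1) + r. As g^r tends to [e], the limit of the representatives of g^q has (k +
   1)-th power [x] modulo the closed kernel. *)
apply: (aleph1_free_divisible Hfree) => k.
have [|y Ky ylim] := lim (fun g => m g %/ k.+1)%N.
  by move=> g; exact: leq_div.
exists (phi y); apply/eqP; rewrite -subr_eq0 -homX -homV -phiM; apply/eqP.
apply: kernel_closed; rewrite -[_ ** _^!]tg_mulg1.
apply: (@ulim_closure _ F _ (fun g => v (g, m g) **
  (tg_pow (v (g, m g %/ k.+1)%N) k.+1)^! ** (tg_pow g (m g %% k.+1))^!)).
  apply: ulim_mul.
    by apply: ulim_mul => //; apply: ulim_inv; apply: ulim_pow.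
  move=> W oW We.
  (* The remainder varies with [g] but takes at most k + 1 values, so finitely many limits
     suffice. *)
  have : F (fun g => forall r, (r < k.+1)%N -> W (tg_pow g r)^!).
    elim: (k.+1) => [|r IH]; first by apply: filterS filterT.
    have := ulim_inv (ulim_pow (n := r) limid) oW; rewrite tg_pow1 tg_invg1.
    move=> /(_ FU We) Fr; apply: filterS2 IH Fr => g IH Wr j.
    by rewrite ltnS leq_eqVlt => /predU1P[->//|/IH].
  by apply: filterS => g; apply; rewrite ltn_mod.
apply: filterS Fnz => g g0; rewrite !phiM !homV !homX.
have [//|_ ->] := vP (g, m g) g0.
have [|_ ->] := vP (g, m g %/ k.+1)%N g0; first exact: leq_div.
by rewrite -mulrnA -addrA -opprD -mulrnDr -divn_eq subrr.
Qed.

End Homomorphism.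
End TopologicalGroup.

Theorem theoremB : forall (H : zmodType), aleph1_free H -> lcH_slender H.
Proof. by move=> H Hfree G phi lcG hausG phiM; exact: kernel_open. Qed.
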